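(* Let $S_n$ be the star graph of order $n\geq 3$ with vertex set $\{v_1,\ldots,v_n\}$, where $v_1\in V(S_n)$ satisfies $\deg(v_1)=n-1$, and let $\mathcal{H}=(H^1,H^2,\ldots,H^n)$ be a sequence of graphs each of which is a path graph or a cycle graph, with $|V(H^i)|>6$ for every $i$. Then $$\dim_{\mathrm{diam}}(S_n\odot\mathcal{H})=|D(S_n\odot\mathcal{H})|+\dim(K_1+H^1).$$
   Context: Distances are shortest-path distances: $d_G(u,v)$ is the length of a shortest $u$–$v$ path in the connected graph $G$. The eccentricity of $v$ is $e_G(v)=\max_{u\in V(G)}d_G(u,v)$ and $\operatorname{diam}(G)=\max_v e_G(v)$. A vertex is diametral if its eccentricity equals $\operatorname{diam}(G)$; the diametral set $D(G)$ is the set of all diametral vertices of $G$. For an ordered set $W=\{w_1,\ldots,w_k\}\subseteq V(G)$, the representation of $v$ is $r(v\mid W)=(d_G(v,w_1),\ldots,d_G(v,w_k))$. $W$ is a resolving set of $G$ if $r(u\mid W)\neq r(v\mid W)$ for all distinct $u,v\in V(G)$. The metric dimension $\dim(G)$ is the minimum cardinality of a resolving set of $G$. A diametral resolving set is a resolving set $W$ with $D(G)\subseteq W$; the diametral metric dimension $\dim_{\mathrm{diam}}(G)$ is the minimum cardinality of a diametral resolving set of $G$. Generalized corona: for a graph $G$ with $V(G)=\{v_1,\ldots,v_n\}$ and a sequence of graphs $\mathcal{H}=(H^1,\ldots,H^n)$, $G\odot\mathcal{H}$ is the graph obtained by taking one copy of $G$ and one (disjoint) copy of each $H^i$, and joining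 the vertex $v_i$ of $G$ to every vertex of the copy of $H^i$, for each $i=1,\ldots,n$. The star graph $S_n$ of order $n$ consists of one center adjacent to $n-1$ leaves. $K_1+H$ denotes the join of a single vertex with $H$, i.e. $H$ together with one new vertex adjacent to every vertex of $H$. *)

(* Defs.v *)
(* MathComp; finite simple graphs are bundled symmetric irreflexive relations. *)
From HB Require Import structures.
From mathcomp Require Import all_boot.

Set Implicit Arguments.
Unset Strict Implicit.
Unset Printing Implicit Defensive.

Record sgraph := SGraph {
  vertex :> finType;
  adj : rel vertex;
  adj_sym : symmetric adj;
  adj_irrefl : irreflexive adj
}.

Definition graph_iso (G H : sgraph) : Prop :=
  exists2 f : G -> H, bijective f & forall u v, adj (f u) (f v) = adj u v.

Section Metric.
Variable G : sgraph.
Implicit Types (u v : G) (W : {set G}).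

Definition degree v : nat := #|[set u | adj v u]|.

(* The vertex sequence of the path is u :: p; its length is the number k of
   edges. *)
Definition has_path_of_length u v (k : nat) : bool :=
  [exists p : k.-tuple G,
     [&& path (@adj G) u p, uniq (u :: p) & last u p == v]].

(* The least k < #|G| such that there is a u-v path of length k. Every path has
   length < #|G|, so the bound excludes nothing; the value is #|G| when u and v
   are not connected. *)
Definition dist u v : nat := find (has_path_of_length u v) (iota 0 #|G|).

Definition ecc v : nat := \max_(u : G) dist u v.

Definition diam : nat := \max_(v : G) ecc v.

Definition diametral_set : {set G} := [set v | ecc v == diam].

Definition representation (s : seq G) v : seq nat := [seq dist v w | w <- s].

(* Whether W is resolving does not depend on the order in which its elements are
   listed; [enum W] is one such listing. *)
Definition resolving W : bool := injectiveb (representation (enum W)).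

Definition diametral_resolving W : bool :=
  resolving W && (diametral_set \subset W).

(* Both minima are over nonempty families: they contain the full vertex set, see
   [resolvingT] and [diametral_resolvingT]. *)
Definition metric_dim : nat := #|[arg min_(W < setT | resolving W) #|W|]|.

Definition diam_metric_dim : nat :=
  #|[arg min_(W < setT | diametral_resolving W) #|W|]|.

Lemma dist_eq0 u v : (dist u v == 0) = (u == v).
Proof.
rewrite /dist; have := fintype0 u; case: #|G| => // m _ /=.
have -> : has_path_of_length u v 0 = (u == v).
  apply/existsP/idP => [[p]|uv]; first by rewrite tuple0 /=.
  by exists [tuple].
by case: (u == v).
Qed.

Lemma resolvingT : resolving setT.
Proof.
apply/injectiveP => u v /eq_in_map/(_ v).
rewrite mem_enum inE => /(_ isT) E; apply/eqP.
by rewrite -dist_eq0 E dist_eq0.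
Qed.

Lemma diametral_resolvingT : diametral_resolving setT.
Proof. by rewrite /diametral_resolving resolvingT subsetT. Qed.

End Metric.

Section Star.
Variable n : nat.
Definition star_adj : rel 'I_n :=
  [rel i j | (i != j) && ((val i == 0) || (val j == 0))].
Lemma star_adj_sym : symmetric star_adj.
Proof. by move=> i j ; rewrite /star_adj /= eq_sym orbC. Qed.
Lemma star_adj_irrefl : irreflexive star_adj.
Proof. by move=> i ; rewrite /star_adj /= eqxx. Qed.
Definition star_graph := SGraph star_adj_sym star_adj_irrefl.
End Star.

Section Path.
Variable n : nat.
Definition path_adj : rel 'I_n :=
  [rel i j | ((val i).+1 == val j) || ((val j).+1 == val i)].
Lemma path_adj_sym : symmetric path_adj.
Proof. by move=> i j ; rewrite /path_adj /= orbC. Qed.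
Lemma path_adj_irrefl : irreflexive path_adj.
Proof. by move=> i ; rewrite /path_adj /= orbb gtn_eqF. Qed.
Definition path_graph := SGraph path_adj_sym path_adj_irrefl.
End Path.

Section Cycle.
Variable n : nat.
(* The condition i != j only matters for n = 1. *)
Definition cycle_adj : rel 'I_n :=
  [rel i j | (i != j) &&
     (((val i).+1 %% n == val j) || ((val j).+1 %% n == val i))].
Lemma cycle_adj_sym : symmetric cycle_adj.
Proof. by move=> i j ; rewrite /cycle_adj /= eq_sym orbC. Qed.
Lemma cycle_adj_irrefl : irreflexive cycle_adj.
Proof. by move=> i ; rewrite /cycle_adj /= eqxx. Qed.
Definition cycle_graph := SGraph cycle_adj_sym cycle_adj_irrefl.
End Cycle.

Definition is_star (n : nat) (G : sgraph) : Prop := graph_iso G (star_graph n).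

Definition is_path (G : sgraph) : Prop :=
  exists2 n, 0 < n & graph_iso G (path_graph n).

Definition is_cycle (G : sgraph) : Prop :=
  exists2 n, 2 < n & graph_iso G (cycle_graph n).

(* K_1 + H, the new vertex being None. *)
Section Cone.
Variable H : sgraph.
Definition cone_adj : rel (option H) := fun x y =>
  match x, y with
  | Some u, Some v => adj u v
  | None, None => false
  | _, _ => true
  end.
Lemma cone_adj_sym : symmetric cone_adj.
Proof. by case=> [u|] [v|] //=; rewrite adj_sym. Qed.
Lemma cone_adj_irrefl : irreflexive cone_adj.
Proof. by case=> [u|] //=; rewrite adj_irrefl. Qed.
Definition cone := SGraph cone_adj_sym cone_adj_irrefl.
End Cone.

(* The sequence of graphs is indexed by the vertices of G. A vertex is either
   inl v with v in G, or inr (Tagged _ x) with x in the copy of H v. *)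
Section Corona.
Variables (G : sgraph) (H : G -> sgraph).
Definition corona_adj : rel (G + {v : G & H v})%type := fun x y =>
  match x, y with
  | inl u, inl v => adj u v
  | inl u, inr b => u == tag b
  | inr a, inl v => v == tag a
  | inr a, inr b => (tag a == tag b) && adj (tagged a) (tagged_as a b)
  end.
Lemma corona_adj_sym : symmetric corona_adj.
Proof.
case=> [u|[u a]] [v|[v b]] //=; first exact: adj_sym.
rewrite [v == u]eq_sym; case: eqP => //= uv; move: b; case: _ / uv => b.
by rewrite !tagged_asE adj_sym.
Qed.
Lemma corona_adj_irrefl : irreflexive corona_adj.
Proof.
by case=> [u|[u a]] /=; rewrite ?tagged_asE adj_irrefl ?andbF.
Qed.
Definition corona := SGraph corona_adj_sym corona_adj_irrefl.
End Corona.

(* Main.v *)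
(* Let c be the centre of the star. The diametral vertices of the corona are the
   vertices of the copies of the H^i attached to the leaves: they have
   eccentricity 4 and every other vertex has eccentricity at most 3. The
   distances to these vertices separate all pairs of vertices except those inside
   the copy of H^c, and such a pair is separated only by vertices of that copy,
   where the distance is the distance of H^c truncated at 2. A set resolving H^c
   for the truncated distance has at least 3 elements, because 2 elements separate
   at most 2 + 2^2 = 6 vertices; as H^c has maximum degree 2, no vertex of H^c is
   adjacent to all of them, so such a set also resolves K_1 + H^c. *)
Require Import Defs.
From mathcomp Require Import all_boot.

Set Implicit Arguments.
Unset Strict Implicit.
Unset Printing Implicit Defensive.

(** * Distances, resolving sets and the distance truncated at 2 *)

Section Distance.
Variable G : sgraph.
Implicit Types (u v w x y : G) (W : {set G}).

(** The Lipschitz condition bounds the length of every path to [v] from below, and repeated descent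
    builds a path attaining the bound. All distances below are computed this way from explicit
    formulas. *)
Lemma dist_unique (v : G) (d : G -> nat) :
    d v = 0 -> (forall x y, adj x y -> d x <= (d y).+1) ->
    (forall x, x != v -> exists2 y, adj x y & d x = (d y).+1) ->
  forall u, dist u v = d u.
Proof.
move=> dv lip desc u.
have d0 x : d x = 0 -> x = v.
  by move=> dx; apply/eqP/negPn/negP => /desc[y _]; rewrite dx.
have lower p x : path (@adj G) x p -> last x p = v -> d x <= size p.
  elim: p x => [x _ /= ->|y p IHp x /=]; first by rewrite dv.
  case/andP=> xy yp /(IHp _ yp) dy; exact: leq_trans (lip _ _ xy) _.
(* The bound on [d] along the path is the induction invariant that makes the path free of
   repetitions. *)
have descent k x : d x = k -> exists p,
    [/\ size p = k, path (@adj G) x p, last x p = v, uniq p &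
        all (fun y => d y < k) p].
  elim: k x => [x /d0->|k IHk x dx]; first by exists [::].
  have [|y xy] := desc x; first by apply: contra_eq_neq dx => ->; rewrite dv.
  rewrite dx => -[/esym dy]; have [p [sz yp lp up ap]] := IHk y dy.
  exists (y :: p); split; rewrite /= ?sz ?xy ?dy ?ltnSn //.
    rewrite up andbT; apply: contraTN ap => yin.
    by apply/allPn; exists y; rewrite // dy ltnn.
  by apply: sub_all ap => z /ltnW.
have [p [sz up lp uniqp ap]] := descent _ u erefl.
have uniq_up : uniq (u :: p).
  rewrite /= uniqp andbT; apply: contraTN ap => uin.
  by apply/allPn; exists u; rewrite // ltnn.
have has_d : has_path_of_length u v (d u).
  apply/existsP; exists (tcast sz (in_tuple p)).
  by rewrite val_tcast /= up lp eqxx -/(uniq (u :: p)) uniq_up.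
(* A repetition-free path has at most [#|G|] vertices, so [d u] lies in the range searched by
   [find]. *)
have dlt : d u < #|G|.
  by rewrite -sz -[(size p).+1]/(size (u :: p)) -(card_uniqP uniq_up) max_card.
have minimal k : has_path_of_length u v k -> d u <= k.
  case/existsP=> q /and3P[uq _ /eqP lq].
  by rewrite -(size_tuple q); apply: lower.
rewrite /dist; set l := iota _ _.
have hasl : has (has_path_of_length u v) l.
  by apply/hasP; exists (d u); rewrite // mem_iota.
apply/eqP; rewrite eqn_leq; apply/andP; split.
  rewrite leqNgt; apply/negP => /(before_find 0).
  by rewrite nth_iota // has_d.
have := nth_find 0 hasl; rewrite nth_iota; last first.
  by rewrite -[X in _ < X](size_iota 0) -has_find.
exact: minimal.
Qed.

Lemma distxx u : dist u u = 0.
Proof. by apply/eqP; rewrite dist_eq0. Qed.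

Lemma resolvingP W :
  reflect (forall u v, {in W, forall w, dist u w = dist v w} -> u = v)
          (resolving W).
Proof.
apply: (iffP (injectiveP _)) => inj u v E; apply: inj.
  by apply/eq_in_map => w; rewrite mem_enum; apply: E.
by move/eq_in_map: E => E w Ww; apply: E; rewrite mem_enum.
Qed.

Lemma metric_dim_le W : resolving W -> metric_dim G <= #|W|.
Proof.
rewrite /metric_dim => resW.
by case: arg_minnP => [|U _]; [apply: resolvingT | apply].
Qed.

Lemma metric_dim_attained :
  exists2 W : {set G}, resolving W & #|W| = metric_dim G.
Proof.
rewrite /metric_dim.
by case: arg_minnP => [|U]; [apply: resolvingT | exists U].
Qed.

Lemma diam_metric_dim_le W : diametral_resolving W -> diam_metric_dim G <= #|W|.
Proof.
rewrite /diam_metric_dim => resW.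
by case: arg_minnP => [|U _]; [apply: diametral_resolvingT | apply].
Qed.

Lemma diam_metric_dim_attained :
  exists2 W : {set G}, diametral_resolving W & #|W| = diam_metric_dim G.
Proof.
rewrite /diam_metric_dim.
by case: arg_minnP => [|U]; [apply: diametral_resolvingT | exists U].
Qed.

Lemma leq_ecc u v : dist u v <= ecc v.
Proof. exact: (leq_bigmax (F := fun x => dist x v)). Qed.

(** This is min(d, 2), with unconnected pairs also at 2: the distance inside [H] once a vertex
    adjacent to all of [H] is added. *)
Definition trunc_dist u v : nat :=
  if u == v then 0 else if adj u v then 1 else 2.

Definition trunc_resolving W : Prop :=
  forall u v, {in W, forall w, trunc_dist u w = trunc_dist v w} -> u = v.

Lemma trunc_distxx u : trunc_dist u u = 0.
Proof. by rewrite /trunc_dist eqxx. Qed.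

Lemma trunc_dist_eq u v : u = v -> trunc_dist u v = 0.
Proof. by move->; apply: trunc_distxx. Qed.

Lemma trunc_dist_eq0 u v : (trunc_dist u v == 0) = (u == v).
Proof. by rewrite /trunc_dist; case: (u == v); case: (adj u v). Qed.

Lemma trunc_dist_eq1 u v : (trunc_dist u v == 1) = adj u v.
Proof.
rewrite /trunc_dist; case: (eqVneq u v) => [->|_]; last by case: adj.
by rewrite adj_irrefl.
Qed.

Lemma trunc_dist_le2 u v : trunc_dist u v <= 2.
Proof. by rewrite /trunc_dist; case: (u == v); case: (adj u v). Qed.

Lemma trunc_dist_lip v x y : adj x y -> trunc_dist x v <= (trunc_dist y v).+1.
Proof.
move=> xy; case: (posnP (trunc_dist y v)) => [/eqP|y_gt0].
  by rewrite trunc_dist_eq0 => /eqP <-; rewrite /trunc_dist xy; case: ifP.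
exact: leq_trans (trunc_dist_le2 _ _) _.
Qed.

(** Diameter at most 2, in the form that supplies the middle vertex of a path. *)
Definition common_neighbours : Prop :=
  forall u v, u != v -> ~~ adj u v -> exists2 w, adj u w & adj w v.

Lemma trunc_dist_descent v x : common_neighbours -> x != v ->
  exists2 y, adj x y & trunc_dist x v = (trunc_dist y v).+1.
Proof.
move=> cn xv; rewrite {1}/trunc_dist (negPf xv).
have [xv_adj | /(cn _ _ xv)[w xw wv]] := boolP (adj x v).
  by exists v; rewrite ?trunc_distxx.
by exists w => //; move: wv; rewrite -trunc_dist_eq1 => /eqP ->.
Qed.

Lemma dist_trunc_dist u v : common_neighbours -> dist u v = trunc_dist u v.
Proof.
move=> cn; apply: (dist_unique (d := trunc_dist^~ v)) => [|x y|x].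
- exact: trunc_distxx.
- exact: trunc_dist_lip.
- exact: trunc_dist_descent.
Qed.

(* A vertex outside W is determined by its neighbours in W. *)
Lemma trunc_resolving_card W : trunc_resolving W -> #|G| <= #|W| + 2 ^ #|W|.
Proof.
move=> resW; rewrite -(cardsC W) leq_add2l -card_powerset.
pose N u := [set w in W | adj u w].
have injN : {in ~: W &, injective N}.
  move=> u v; rewrite !inE => uW vW /setP E; apply: resW => w Ww.
  have := E w; rewrite !inE Ww /= /trunc_dist => ->.
  have neq z : z \notin W -> (z == w) = false.
    by move=> zW; apply: contraNF zW => /eqP ->.
  by rewrite !neq.
rewrite -(card_in_imset injN); apply: subset_leq_card; apply/subsetP => A.
case/imsetP=> u _ ->; rewrite inE; apply/subsetP => w.
by rewrite inE => /andP[].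
Qed.

End Distance.

(** * Resolving sets of a cone *)

Section Cone.
Variable H : sgraph.
Implicit Types W : {set H}.

Lemma dist_cone (x y : cone H) : dist x y = trunc_dist x y.
Proof.
by apply: dist_trunc_dist => -[u|] [v|] // _ _; exists (None : cone H).
Qed.

Lemma trunc_dist_cone (a b : H) :
  trunc_dist (Some a : cone H) (Some b) = trunc_dist a b.
Proof. by []. Qed.

(** The apex is at distance 1 from all of [H], so discarding it from [W] loses no separation inside
    [H]. *)
Lemma cone_resolving_trunc (W : {set cone H}) :
  resolving W -> trunc_resolving (Some @^-1: W).
Proof.
move/resolvingP => resW a b E.
suff: (Some a : cone H) = Some b by case.
apply: resW => -[w|] Ww; rewrite !dist_cone //.
by rewrite !trunc_dist_cone E // inE.
Qed.

Lemma trunc_resolving_cone W :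
    (forall a : H, degree a <= 2) -> 6 < #|H| -> trunc_resolving W ->
  resolving (Some @: W : {set cone H}).
Proof.
move=> deg2 cardH resW.
have W_gt2 : 2 < #|W|.
  rewrite ltnNge; apply/negP => W_le2.
  have := leq_trans cardH (trunc_resolving_card resW); rewrite ltnNge.
  by rewrite (leq_trans (leq_add W_le2 (leq_pexp2l _ W_le2))).
(* The apex is adjacent to every element of [W]; a vertex [a] with the same distances would have at
   least 3 neighbours. *)
have apex (a : H) : ~ {in Some @: W, forall w : cone H,
    dist (Some a : cone H) w = dist (None : cone H) w}.
  move=> E; have := deg2 a; rewrite leqNgt => /negP; apply.
  apply: leq_trans W_gt2 _; apply: subset_leq_card; apply/subsetP => w Ww.
  have := E (Some w); rewrite imset_f // => /(_ isT).
  by rewrite !dist_cone inE -trunc_dist_eq1 -trunc_dist_cone => ->.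
apply/resolvingP => -[a|] [b|] // E.
- congr Some; apply: resW => w Ww.
  have := E (Some w); rewrite imset_f // => /(_ isT).
  by rewrite !dist_cone.
- by case: (apex a).
- by case: (apex b) => w /E.
Qed.

End Cone.

(** * Degrees in paths and cycles *)

Section Degree.

Lemma graph_iso_degree_le (G K : sgraph) k :
  graph_iso G K -> (forall y : K, degree y <= k) -> forall x : G, degree x <= k.
Proof.
case=> f /bij_inj injf fE degK x; apply: leq_trans (degK (f x)).
rewrite /degree -(card_imset _ injf); apply: subset_leq_card.
by apply/subsetP => y /imsetP[u]; rewrite !inE -fE => xu ->.
Qed.

(** Injectivity of [t] leaves at most one successor of [v], and that of [s] at most one predecessor.
    The separate type [T] accommodates the last vertex of a path, whose successor is only a
    number. *)
Lemma degree_successor_le2 (G : sgraph) (T : eqType) (t s : G -> T) :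
    injective t -> injective s ->
    (forall u v : G, adj u v -> (s u == t v) || (s v == t u)) ->
  forall v : G, degree v <= 2.
Proof.
move=> injt injs adjE v.
have le1 (A : {set G}) : {in A &, forall x y, x = y} -> #|A| <= 1.
  by move=> eqA; apply/card_le1_eqP => x y Ax Ay; apply: eqA.
apply: (@leq_trans #|[set u : G | s v == t u] :|: [set u : G | s u == t v]|).
  by apply: subset_leq_card; apply/subsetP => u; rewrite !inE; apply: adjE.
apply: leq_trans (leq_card_setU _ _) (@leq_add _ _ 1 1 _ _);
  apply: le1 => x y; rewrite !inE.
  by move=> /eqP sx /eqP sy; apply: injt; rewrite -sx.
by move=> /eqP sx /eqP sy; apply: injs; rewrite sx.
Qed.

Lemma path_degree_le2 (G : sgraph) : is_path G -> forall v : G, degree v <= 2.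
Proof.
case=> n _ /graph_iso_degree_le; apply.
apply: (@degree_successor_le2 (path_graph n) nat (@nat_of_ord n)
         (fun i : 'I_n => i.+1)) => //.
  exact: ord_inj.
by move=> i j /succn_inj; apply: ord_inj.
Qed.

Lemma cycle_degree_le2 (G : sgraph) : is_cycle G -> forall v : G, degree v <= 2.
Proof.
case=> n _ /graph_iso_degree_le; apply.
apply: (@degree_successor_le2 (cycle_graph n) nat (@nat_of_ord n)
         (fun i : 'I_n => i.+1 %% n)).
- exact: ord_inj.
- move=> i j /eqP.
  rewrite -(addn1 i) -(addn1 j) eqn_modDr !modn_small ?ltn_ord //.
  by move/eqP; apply: ord_inj.
- by move=> i j; rewrite /= => /andP[].
Qed.

End Degree.

(** * Recognising the centre of a star by its degree *)

Lemma is_star_adj n (S : sgraph) (c : S) :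
    is_star n S -> 2 < n -> degree c = n - 1 ->
  forall u v, adj u v = (u != v) && ((u == c) || (v == c)).
Proof.
move=> [f bijf fE] n_gt2 degc; have injf := bij_inj bijf.
pose g u : nat := (f u : 'I_n).
have injg : injective g by move=> u v /ord_inj/injf.
have adjE u v : adj u v = (u != v) && ((g u == 0) || (g v == 0)).
  by rewrite -fE /= /star_adj /= (inj_eq injf).
(* Otherwise [c] is a leaf, of degree at most 1, whereas n - 1 is at least 2. *)
have gc : g c = 0.
  apply/eqP/negPn/negP => gc_neq0.
  have: degree c <= 1.
    apply/card_le1_eqP => x y; rewrite !inE !adjE (negPf gc_neq0) /=.
    by move=> /andP[_ /eqP gx] /andP[_ /eqP gy]; apply: injg; rewrite gx.
  by rewrite degc leqNgt ltn_subRL addn1 n_gt2.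
by move=> u v; rewrite adjE -!gc !(inj_eq injg).
Qed.

Lemma is_star_card n (S : sgraph) : is_star n S -> #|S| = n.
Proof. by case=> f bijf _; rewrite (bij_eq_card bijf) card_ord. Qed.

(** * Distances in a corona over a graph of diameter at most 2 *)

Section Corona.
Variables (S : sgraph) (H : S -> sgraph).
Implicit Types (x y z : corona H).

(** Entering or leaving a copy costs one edge; within a copy the attaching vertex caps the distance
    at 2. *)
Definition corona_dist x y : nat :=
  match x, y with
  | inl u, inl v => trunc_dist u v
  | inl u, inr b => (trunc_dist u (tag b)).+1
  | inr a, inl v => (trunc_dist (tag a) v).+1
  | inr a, inr b =>
      if tag a == tag b then trunc_dist (tagged a) (tagged_as a b)
      else (trunc_dist (tag a) (tag b)).+2
  end.

Lemma dist_corona x y : common_neighbours S -> dist x y = corona_dist x y.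
Proof.
move=> cn; apply: (dist_unique (d := corona_dist^~ y)) => [|{}x z|{}x].
- by case: y => [v|[v b]] /=; rewrite ?eqxx ?tagged_asE trunc_distxx.
- case: x => [u|[u a]]; case: z => [w|[w c]]; case: y => [v|[v b]] //=.
  + exact: trunc_dist_lip.
  + exact: trunc_dist_lip.
  + by move/eqP=> ->; rewrite !leqW.
  + by move/eqP=> ->; case: eqP => [/trunc_dist_eq ->|_]; rewrite // ltnS !leqW.
  + by move/eqP=> ->.
  + move/eqP=> ->; case: eqP => [/trunc_dist_eq ->|_ //].
    exact: trunc_dist_le2.
  + by case/andP=> /eqP uw _; rewrite uw ltnS.
  + case/andP=> /eqP uw; case: _ / uw c => c; rewrite tagged_asE => ac.
    case: eqP => [uv|//]; case: _ / uv b => b.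
    by rewrite !tagged_asE; apply: trunc_dist_lip.
(* Descent: in [S], move towards the attaching vertex of the target, or enter its copy; from a copy,
   move to the attaching vertex unless the target is an adjacent vertex of the same copy. *)
- case: x => [u|[u a]]; case: y => [v|[v b]] //= neq.
  + have [|w uw ->] := trunc_dist_descent (x := u) (v := v) cn.
      by apply: contraNneq neq => ->.
    by exists (inl w : corona H).
  + have [->|uv] := eqVneq u v.
      exists (inr (Tagged H b) : corona H) => //=.
      by rewrite eqxx tagged_asE !trunc_distxx.
    have [w uw ->] := trunc_dist_descent cn uv.
    by exists (inl w : corona H).
  + by exists (inl u : corona H) => //=.
  + have [uv|uv] := eqVneq u v; last by exists (inl u : corona H) => //=.
    case: _ / uv b neq => b neq; rewrite tagged_asE {1}/trunc_dist.
    rewrite ifN_eq; last by apply: contraNneq neq => ->.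
    case: ifP => ab.
      exists (inr (Tagged H b) : corona H); rewrite /= ?eqxx ?tagged_asE //.
      by rewrite trunc_distxx.
    by exists (inl u : corona H) => //=; rewrite trunc_distxx.
Qed.

End Corona.

(** * Coronas over a star: diametral vertices and what they separate *)

Section StarCorona.
Variables (S : sgraph) (c : S) (H : S -> sgraph).
Hypothesis starS : forall u v, adj u v = (u != v) && ((u == c) || (v == c)).
Hypothesis S_gt2 : 2 < #|S|.
Hypothesis H_gt0 : forall v, 0 < #|H v|.
Implicit Types (x y : corona H) (W : {set corona H}).

Lemma star_common_neighbours : common_neighbours S.
Proof.
move=> u v uv; rewrite starS uv /= negb_or => /andP[uc vc].
by exists c; rewrite starS eqxx ?orbT andbT // eq_sym.
Qed.

Let distE x y : dist x y = corona_dist x y.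
Proof. exact: dist_corona star_common_neighbours. Qed.

Lemma star_trunc_dist_centre u : u != c -> trunc_dist u c = 1.
Proof. by move=> uc; apply/eqP; rewrite trunc_dist_eq1 starS uc eqxx orbT. Qed.

Lemma star_trunc_dist_centrel u : u != c -> trunc_dist c u = 1.
Proof. by move=> uc; apply/eqP; rewrite trunc_dist_eq1 starS eq_sym uc eqxx. Qed.

Lemma star_trunc_dist_leaves u v :
  u != v -> u != c -> v != c -> trunc_dist u v = 2.
Proof.
move=> uv uc vc.
by rewrite /trunc_dist starS (negPf uv) (negPf uc) (negPf vc) andbF.
Qed.

Lemma star_other_leaf u : exists2 v, v != u & v != c.
Proof.
have : 0 < #|~: [set u; c]|.
  rewrite cardsCs setCK subn_gt0 cards2.
  by apply: leq_ltn_trans S_gt2; case: eqP.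
by case/card_gt0P=> v; rewrite !inE negb_or => /andP[]; exists v.
Qed.

Definition leaf_copies : {set corona H} :=
  [set x | if x is inr a then tag a != c else false].

Lemma ecc_leaf_copies x : x \in leaf_copies -> 4 <= ecc x.
Proof.
rewrite inE; case: x => [//|[u a]] /= uc.
(* A vertex in the copy at a second leaf is at distance 1 + 2 + 1. *)
have [v vu vc] := star_other_leaf u; have /card_gt0P[b _] := H_gt0 v.
apply: leq_trans (leq_ecc (inr (Tagged H b) : corona H) _).
by rewrite distE /= (negPf vu) star_trunc_dist_leaves.
Qed.

Lemma ecc_le4 x : ecc x <= 4.
Proof.
apply/bigmax_leqP => y _; rewrite distE.
case: x y => [u|[u a]] [v|[v b]] /=; rewrite ?ltnS;
  do ?[case: ifP => _]; rewrite ?ltnS ?(leq_trans (trunc_dist_le2 _ _)) //.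
Qed.

Lemma ecc_notin_leaf_copies x : x \notin leaf_copies -> ecc x <= 3.
Proof.
rewrite inE => xD; apply/bigmax_leqP => y _; rewrite distE.
case: x y xD => [u|[u a]] [v|[v b]] /=;
  rewrite ?ltnS ?(leq_trans (trunc_dist_le2 _ _)) //.
move/negPn/eqP=> uc; case: eqVneq => [_|vu].
  exact: leq_trans (trunc_dist_le2 _ _) _.
by rewrite uc star_trunc_dist_centre // -uc.
Qed.

Lemma diametral_set_star_corona : diametral_set (corona H) = leaf_copies.
Proof.
have diam4 : diam (corona H) = 4.
  apply/eqP; rewrite eqn_leq; apply/andP; split.
    by apply/bigmax_leqP => x _; apply: ecc_le4.
  have [u _ uc] := star_other_leaf c; have /card_gt0P[a _] := H_gt0 u.
  apply: leq_trans (leq_bigmax (inr (Tagged H a) : corona H)).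
  by apply: ecc_leaf_copies; rewrite inE.
apply/setP => x; rewrite [in LHS]inE diam4.
apply/idP/idP => [/eqP ex|xD].
  by apply/negPn/negP => /ecc_notin_leaf_copies; rewrite ex.
by rewrite eqn_leq ecc_le4 ecc_leaf_copies.
Qed.

Definition centre_copy (a : H c) : corona H := inr (Tagged H a).

Lemma centre_copy_inj : injective centre_copy.
Proof.
(* Passing through distance 0 avoids inverting an equality of dependent pairs. *)
move=> a b E; apply/eqP; rewrite -trunc_dist_eq0.
have := distxx (centre_copy b); rewrite -{1}E distE /= eqxx tagged_asE.
by move=> ->.
Qed.

Lemma dist_centre_copy a b :
  dist (centre_copy a) (centre_copy b) = trunc_dist a b.
Proof. by rewrite distE /= eqxx tagged_asE. Qed.

(** Every path leaving the central copy goes through [c], so its starting vertex in the copy does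
    not matter. *)
Lemma dist_centre_copy_other a b x :
  x \notin centre_copy @: setT ->
  dist (centre_copy a) x = dist (centre_copy b) x.
Proof.
rewrite !distE; case: x => [v|[v d]] //=; case: eqVneq => // cv.
by case: _ / cv d => d; rewrite imset_f.
Qed.

Lemma centre_copy_trunc_resolving W :
  resolving W -> trunc_resolving (centre_copy @^-1: W).
Proof.
move/resolvingP=> resW a b E; apply/centre_copy_inj/resW => x Wx.
have [/imsetP[w _ xw]|] := boolP (x \in centre_copy @: setT).
  by rewrite xw !dist_centre_copy E // inE -xw.
exact: dist_centre_copy_other.
Qed.

Lemma leaf_copies_separate x y :
    {in leaf_copies, forall z, dist x z = dist y z} -> x != y ->
  exists a b, x = centre_copy a /\ y = centre_copy b.
Proof.
move=> E xy.
(* A vertex of a leaf copy is itself a landmark, singled out by its distance 0. *)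
have notD x' y' : {in leaf_copies, forall z, dist x' z = dist y' z} ->
    x' != y' -> x' \notin leaf_copies.
  move=> E' xy'; apply: contra xy' => /E'; rewrite distxx => /esym/eqP.
  by rewrite dist_eq0 eq_sym.
have {notD} [xD yD] : x \notin leaf_copies /\ y \notin leaf_copies.
  split; first exact: notD E xy.
  by apply: notD (x) _ _; rewrite 1?eq_sym // => z /E.
have toleaf u : u != c -> exists2 z, z \in leaf_copies &
    (forall v, dist (inl v : corona H) z = (trunc_dist v u).+1) /\
    (forall a, dist (centre_copy a) z = 3).
  move=> uc; have /card_gt0P[d _] := H_gt0 u.
  exists (inr (Tagged H d) : corona H); first by rewrite inE.
  split=> [v|a]; rewrite distE //= eq_sym (negPf uc).
  by rewrite star_trunc_dist_centrel.
have copyE z : z \notin leaf_copies -> (exists u, z = inl u) \/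
    (exists a, z = centre_copy a).
  rewrite inE; case: z => [u|[u a]] /=; first by left; exists u.
  by move/negPn/eqP=> uc; right; case: _ / (esym uc) a => a; exists a.
(* Leaf copies see the central copy at distance 3, but [c] at distance 2, and a leaf is at distance
   1 from its own copy. *)
have mixed u a : ~ {in leaf_copies, forall z,
    dist (inl u : corona H) z = dist (centre_copy a) z}.
  move=> E'; have [uc|uc] := eqVneq u c.
    have [v _ vc] := star_other_leaf u; have [z Dz [zl zc]] := toleaf v vc.
    by have := E' z Dz; rewrite zl zc uc star_trunc_dist_centrel.
  have [z Dz [zl zc]] := toleaf u uc.
  by have := E' z Dz; rewrite zl zc trunc_distxx.
case: (copyE x xD) (copyE y yD) => [[u xu]|[a xa]] [[v yv]|[b yb]].
(* A leaf is the only vertex of the star at distance 1 from its copy; of two distinct star vertices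
   at least one is a leaf. *)
- have sep u' v' : {in leaf_copies, forall z, dist (inl u' : corona H) z =
      dist (inl v' : corona H) z} -> u' != c -> u' = v'.
    move=> E' u'c; have [z Dz [zl _]] := toleaf u' u'c.
    have := E' z Dz; rewrite !zl trunc_distxx => -[] /esym/eqP.
    by rewrite trunc_dist_eq0 => /eqP.
  case/eqP: xy; rewrite xu yv; congr inl.
  have [uc|] := eqVneq u c; last by apply: sep; rewrite -xu -yv.
  have [->//|vc] := eqVneq v c.
  by apply/esym/sep => // z /E; rewrite xu yv.
- by case: (mixed u b) => z /E; rewrite xu yb.
- by case: (mixed v a) => z /E; rewrite xa yv.
- by exists a, b.
Qed.

Lemma leaf_copiesU_resolving (A : {set H c}) :
  trunc_resolving A -> resolving (leaf_copies :|: centre_copy @: A).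
Proof.
move=> resA; apply/resolvingP => x y E; apply/eqP/negPn/negP => xy.
have [|a [b [xa yb]]] := leaf_copies_separate _ xy.
  by move=> z Dz; apply: E; rewrite inE Dz.
case/eqP: xy; rewrite xa yb; congr centre_copy; apply: resA => w Aw.
have := E (centre_copy w); rewrite xa yb !dist_centre_copy; apply.
by rewrite inE imset_f ?orbT.
Qed.

Lemma diam_metric_dim_star_corona :
    (forall a : H c, degree a <= 2) -> 6 < #|H c| ->
  diam_metric_dim (corona H) =
    #|diametral_set (corona H)| + metric_dim (cone (H c)).
Proof.
move=> deg2 Hc_gt6; rewrite diametral_set_star_corona.
apply/eqP; rewrite eqn_leq; apply/andP; split.
  (* Upper bound: a minimum resolving set of the cone, without the apex, is moved to the central
     copy and joined to the leaf copies. *)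
  have [U /cone_resolving_trunc resU <-] := metric_dim_attained (cone (H c)).
  apply: leq_trans (diam_metric_dim_le (W := leaf_copies :|: _) _) _; last first.
  - apply: leq_trans (leq_card_setU _ _) _; rewrite leq_add2l.
    apply: leq_trans (leq_imset_card centre_copy (Some @^-1: U)) _.
    rewrite -(card_imset _ Some_inj); apply: subset_leq_card.
    by apply/subsetP => x /imsetP[a]; rewrite inE => Ua ->.
  - rewrite /diametral_resolving leaf_copiesU_resolving //=.
    by rewrite diametral_set_star_corona subsetUl.
(* Lower bound: the part of [W] in the central copy yields a resolving set of the cone and is
   disjoint from the leaf copies, which [W] contains. *)
have [W /andP[resW]] := diam_metric_dim_attained (corona H).
rewrite diametral_set_star_corona => DW <-.
have resA := centre_copy_trunc_resolving resW.
have := metric_dim_le (trunc_resolving_cone deg2 Hc_gt6 resA).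
rewrite card_imset; last exact: Some_inj.
rewrite -(leq_add2l #|leaf_copies|) => /leq_trans; apply.
rewrite -(card_imset _ centre_copy_inj) -cardsUI.
rewrite (_ : leaf_copies :&: _ = set0) ?cards0 ?addn0.
  apply: subset_leq_card; rewrite subUset DW.
  by apply/subsetP => x /imsetP[a]; rewrite inE => Wa ->.
apply/setP => x; rewrite !inE; apply/negP => /andP[Dx /imsetP[a _ xa]].
by move: Dx; rewrite xa /= eqxx.
Qed.

End StarCorona.

Theorem theorem3p4 (n : nat) (hn : 3 <= n) (S : sgraph) (hS : is_star n S)
    (v1 : S) (hv1 : degree v1 = n - 1) (H : S -> sgraph)
    (hH : forall v : S, is_path (H v) \/ is_cycle (H v))
    (hcard : forall v : S, 6 < #|H v|) :
  diam_metric_dim (corona H) =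
    #|diametral_set (corona H)| + metric_dim (cone (H v1)).
Proof.
apply: diam_metric_dim_star_corona => //.
- exact: is_star_adj hS hn hv1.
- by rewrite (is_star_card hS).
- by move=> v; apply: leq_trans (hcard v).
- by case: (hH v1) => [/path_degree_le2|/cycle_degree_le2].
Qed.
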